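(* Let $d$ be a positive integer, $x\in\mathbb R$, $f$ a real-valued function which is $2d+1$ times differentiable at $x$, and $g$ a real-valued function which is $2d+1$ times differentiable at $f(x)$. Suppose $Df(x)\ne 0$, $Dg(f(x))\neq 0$, $S_d(f)(x)$ and $S_d(g)(f(x))$ exist, and for every $1\le k<d$ the Schwarzian derivatives $S_k(f)(x)$ and $S_k(g)(f(x))$ exist and satisfy $S_k(f)(x)\ge 0$, $S_k(g)(f(x))\ge 0$. Then $S_d(g\circ f)(x)$ exists and $$S_d(g\circ f)(x) \ge S_d(g)(f(x))\,(Df(x))^{2d} + S_d(f)(x).$$
   Context: $D$ denotes differentiation; functions are defined on real neighbourhoods of the relevant points. Padé approximants and Schwarzian derivatives: a rational map is a quotient $p/q$ of polynomials with $q \not\equiv 0$; its degree is $\max(\deg p,\deg q)$ when $p,q$ are relatively prime. Let $k \ge 0$ be an integer and $h$ a real-valued function which is $2k$ times differentiable at a real point $y$. The $k$'th Padé approximant to $h$ at $y$, denoted $[h]_y^k$, is the rational map $\mathcal R$ of degree at most $k$ (finite at $y$) with $D^j\mathcal R(y) = D^j h(y)$ for $0 \le j \le 2k$, if such a map exists (it is then unique). If moreover $h$ is $2k+1$ times differentiable at $y$, $Dh(y) \ne 0$, $k\ge 1$, and $\mathcal R = [h]_y^k$ exists, the Schwarzian derivative of order $k$ is $S_k(h)(y) = D^{2k+1}(\mathcal R^{-1}\circ h)(y)$, where $\mathcal R^{-1}$ is the local inverse of $\mathcal R$ sending $h(y)$ to $y$; equivalently $S_k(h)(y) = D^{2k+1}(h-\mathcal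 R)(y)/Dh(y)$. We say $S_k(h)(y)$ exists when $[h]_y^k$ exists. *)

(* Defs.v *)
From HB Require Import structures.
From mathcomp Require Import all_boot all_order all_algebra.
From mathcomp Require Import all_classical all_reals all_analysis.

Set Implicit Arguments.
Unset Strict Implicit.
Unset Printing Implicit Defensive.

Import Order.TTheory GRing.Theory Num.Theory.
Import numFieldNormedType.Exports.

Local Open Scope ring_scope.
Local Open Scope classical_set_scope.

(* Functions defined on a real neighbourhood of a point are represented by
   total functions [R -> R]; every notion below is local at its base point. *)

(* [h^`(j)] is total, with junk values where the limit does not exist, so
   differentiability of the lower derivatives on a neighbourhood of [y] is
   required explicitly. *)
Definition n_differentiable (R : realType) (n : nat) (h : R -> R) (y : R)
    : Prop :=
  (forall j : nat, (j < n)%N -> derivable (h^`(j)) y 1) /\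
  (forall j : nat, (j.+1 < n)%N -> \forall z \near y, derivable (h^`(j)) z 1).

(* A pair [(p, q)] represents the rational map [p / q], in lowest terms. *)
Definition is_ratmap (R : realType) (r : {poly R} * {poly R}) : Prop :=
  r.2 != 0 /\ coprimep r.1 r.2.

Definition ratmap_degree (R : realType) (r : {poly R} * {poly R}) : nat :=
  maxn (size r.1).-1 (size r.2).-1.

(* The value at a pole is junk. *)
Definition ratmap_fun (R : realType) (r : {poly R} * {poly R}) : R -> R :=
  fun z => r.1.[z] / r.2.[z].

Definition is_pade (R : realType) (k : nat) (h : R -> R) (y : R)
    (r : {poly R} * {poly R}) : Prop :=
  [/\ is_ratmap r,
      (ratmap_degree r <= k)%N,
      r.2.[y] != 0 &
      forall j : nat, (j <= 2 * k)%N -> (ratmap_fun r)^`(j) y = h^`(j) y].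

Definition pade_exists (R : realType) (k : nat) (h : R -> R) (y : R) : Prop :=
  n_differentiable (2 * k) h y /\ exists r, is_pade k h y r.

(* The pair is unique up to a common nonzero scalar, hence the map itself does
   not depend on the choice. *)
Definition pade (R : realType) (k : nat) (h : R -> R) (y : R) : R -> R :=
  ratmap_fun (xget (0, 1) [set r | is_pade k h y r]).

Definition is_local_inverse (R : realType) (F : R -> R) (y : R)
    (phi : R -> R) : Prop :=
  [/\ phi (F y) = y,
      \forall z \near y, phi (F z) = z &
      \forall w \near F y, F (phi w) = w].

(* When [F] is a local homeomorphism at [y], the germ at [F y] does not depend
   on the choice. *)
Definition local_inverse (R : realType) (F : R -> R) (y : R) : R -> R :=
  xget (fun=> y) [set phi | is_local_inverse F y phi].

(* The Padé approximant [F] satisfies [F y = h y], so the inverse sends [h y]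
   to [y]. *)
Definition schwarzian (R : realType) (k : nat) (h : R -> R) (y : R) : R :=
  (local_inverse (pade k h y) y \o h)^`((2 * k).+1)%classic y.

(* Includes the conditions under which the order [k] Schwarzian derivative is
   defined at all. *)
Definition schwarzian_exists (R : realType) (k : nat) (h : R -> R) (y : R)
    : Prop :=
  [/\ (1 <= k)%N,
      n_differentiable (2 * k).+1 h y,
      h^`() y != 0 &
      pade_exists k h y].

(* Main.v *)
Require Import Defs.
From HB Require Import structures.
From mathcomp Require Import all_boot all_order all_algebra.
From mathcomp Require Import ring lra zify.
From mathcomp Require Import all_classical all_reals all_analysis.

Set Implicit Arguments.
Unset Strict Implicit.
Unset Printing Implicit Defensive.

Import Order.TTheory GRing.Theory Num.Theory.
Import numFieldNormedType.Exports.

Local Open Scope ring_scope.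
Local Open Scope classical_set_scope.

(** Write [A] for the Taylor coefficients of [h - h y] at [y] and [H] for the
    Hankel matrix [(a_(i+j+1))_(0 <= i, j <= d)].  The normalized denominators
    [q_k] of the Padé approximants of orders [k <= d], read from the top
    coefficient down, are the rows of a unitriangular [V] such that [V H V^T] is diagonal with entries
    [s_k = (q_k A)_(2k+1)], and [S_k = (2k+1)! s_k / a_1].  Hence the
    nonnegativity of the [S_k], [k < d], means that [H / a_1] is positive
    semidefinite once [a_(2d+1)] is decreased by [s_d].  Since
    [H(g o f) = sum_(a, b) g_(a+b+1) T^a H(f) (T^T)^b], with [T] the Toeplitz
    matrix of [f], this semidefiniteness passes to compositions; a semidefinite
    Hankel matrix in turn yields the order [d] Padé denominator and the sign of
    its last entry.  Restoring the two top coefficients gives the inequality. *)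

(** * Hankel and Toeplitz matrices of truncated power series under product and composition *)

Section HankelToeplitz.
Variables (R : comNzRingType) (d : nat).
Implicit Types p q : {poly R}.

Definition hankel p : 'M[R]_d.+1 := \matrix_(i, j) p`_(i + j).+1.

(** The lower triangular matrix of multiplication by [p] modulo ['X^d.+1]. *)
Definition toeplitz p : 'M[R]_d.+1 :=
  \matrix_(i, j) if (j <= i)%N then p`_(i - j) else 0.

Lemma sum_ord_leq (m n : nat) (F : nat -> R) : (m < n)%N ->
  \sum_(l < n) (if (l <= m)%N then F l else 0) = \sum_(l < m.+1) F l.
Proof.
move=> lt_mn; rewrite (big_ord_widen n F lt_mn) [RHS]big_mkcond /=.
by apply: eq_bigr => i _; rewrite ltnS.
Qed.

(** A Leibniz rule. The convolution giving the coefficient [(i + j).+1] of [p * q] splits by the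
    index of [p]: indices up to [i] give the first product, the [j.+1] larger ones the second. *)
Lemma hankelM p q :
  hankel (p * q) = toeplitz p *m hankel q + hankel p *m (toeplitz q)^T.
Proof.
apply/matrixP => i j; rewrite !mxE coefM.
have -> : \sum_(l < d.+1) toeplitz p i l * hankel q l j =
    \sum_(l < i.+1) p`_l * q`_((i + j).+1 - l).
  rewrite [RHS](reindex_inj rev_ord_inj) /= -(sum_ord_leq (n := d.+1)
    (fun l => p`_(i.+1 - l.+1) * q`_((i + j).+1 - (i.+1 - l.+1)))) //.
  apply: eq_bigr => l _; rewrite !mxE; case: leqP => [le_li|]; last by rewrite mul0r.
  by rewrite subSS; congr (_ * q`__); lia.
have -> : \sum_(l < d.+1) hankel p i l * (toeplitz q)^T l j =
    \sum_(l < j.+1) p`_(i.+1 + l) * q`_((i + j).+1 - (i.+1 + l)).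
  rewrite -(sum_ord_leq (n := d.+1)
    (fun l => p`_(i.+1 + l) * q`_((i + j).+1 - (i.+1 + l)))) //.
  apply: eq_bigr => l _; rewrite !mxE; case: leqP => [le_lj|]; last by rewrite mulr0.
  by congr (_ * q`__); lia.
rewrite -addSn -(addnS i.+1 j) big_split_ord /=.
by congr (_ + _).
Qed.

Lemma toeplitzM p q : toeplitz (p * q) = toeplitz p *m toeplitz q.
Proof.
apply/matrixP => i j; rewrite !mxE.
have -> : \sum_(l < d.+1) toeplitz p i l * toeplitz q l j =
   \sum_(l < i.+1) if (l <= i - j)%N && (j <= i)%N then p`_l * q`_(i - j - l) else 0.
  rewrite [RHS](reindex_inj rev_ord_inj) /= -(sum_ord_leq (n := d.+1)
    (fun l => if (i.+1 - l.+1 <= i - j)%N && (j <= i)%N then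
       p`_(i.+1 - l.+1) * q`_(i - j - (i.+1 - l.+1)) else 0)) //.
  apply: eq_bigr => l _; rewrite !mxE subSS.
  case: (leqP l i) => [le_li|]; last by rewrite mul0r.
  case: (leqP j l) => [le_jl|lt_lj].
    rewrite ifT; last by apply/andP; split; lia.
    by congr (_ * q`__); lia.
  by rewrite mulr0 ifF //; apply/negbTE/negP => /andP[]; lia.
case: leqP => [le_ji|_]; last by rewrite big1 // => l _; rewrite andbF.
under eq_bigr do rewrite andbT.
by rewrite (sum_ord_leq (fun l => p`_l * q`_(i - j - l))) ?coefM //; lia.
Qed.

Lemma toeplitz1 : toeplitz 1 = 1%:M.
Proof.
apply/matrixP => i j; rewrite !mxE coef1 -val_eqE /=.
by case: (ltngtP j i) => [lt_ji|//|->]; rewrite ?subnn // subn_eq0 leqNgt lt_ji.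
Qed.

Lemma hankel1 : hankel 1 = 0.
Proof. by apply/matrixP => i j; rewrite !mxE coef1. Qed.

Lemma coef_exp_lt p n i : p`_0 = 0 -> (i < n)%N -> (p ^+ n)`_i = 0.
Proof.
move=> p0; have -> : p = drop_poly 1 p * 'X.
  rewrite -{1}(poly_take_drop 1 p) expr1 [take_poly 1 p](_ : _ = 0) ?add0r //.
  by apply/polyP => -[|j]; rewrite coef_take_poly coef0.
by move=> lt_in; rewrite exprMn coefMXn lt_in.
Qed.

Lemma coef_exp_diag p n : p`_0 = 0 -> (p ^+ n)`_n = p`_1 ^+ n.
Proof.
move=> p0; have -> : p = drop_poly 1 p * 'X.
  rewrite -{1}(poly_take_drop 1 p) expr1 [take_poly 1 p](_ : _ = 0) ?add0r //.
  by apply/polyP => -[|j]; rewrite coef_take_poly coef0.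
rewrite exprMn coefMXn ltnn subnn coefMX /=.
by rewrite -!horner_coef0 horner_exp.
Qed.

Lemma toeplitz_exp0 p n : p`_0 = 0 -> (d < n)%N -> toeplitz (p ^+ n) = 0.
Proof.
move=> p0 lt_dn; apply/matrixP => i j; rewrite !mxE.
case: leqP => // _; apply: coef_exp_lt => //.
by apply: leq_ltn_trans lt_dn; apply: leq_trans (leq_subr _ _) _; rewrite -ltnS.
Qed.

(** Iterate [hankelM] on [p * p ^+ n]: the left Toeplitz factor shifts [a] by one, and the other
    term supplies [a = 0]. Since [p] has no constant term, [toeplitz p] is nilpotent and exponents
    up to [d] suffice. *)
Lemma hankel_exp p n : p`_0 = 0 ->
  hankel (p ^+ n) = \sum_(a < d.+1) \sum_(b < d.+1)
    ((a + b).+1 == n)%:R *: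
      (toeplitz (p ^+ a) *m hankel p *m (toeplitz (p ^+ b))^T).
Proof.
move=> p0; elim: n => [|n IHn].
  rewrite expr0 hankel1 big1 // => a _; rewrite big1 // => b _.
  by rewrite scale0r.
rewrite exprS hankelM IHn mulmx_sumr.
pose F a := \sum_(b < d.+1) ((a + b)%N == n)%:R *:
      (toeplitz (p ^+ a) *m hankel p *m (toeplitz (p ^+ b))^T).
have FS : F d.+1 = 0.
  by rewrite /F big1 // => b _; rewrite toeplitz_exp0 // !mul0mx scaler0.
have F0 : F 0 = hankel p *m (toeplitz (p ^+ n))^T.
  rewrite /F expr0 toeplitz1 mul1mx; case: (ltnP n d.+1) => [lt_nd|lt_dn].
    rewrite (bigD1 (Ordinal lt_nd)) //= eqxx scale1r big1 ?addr0 // => b nb.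
    by rewrite -val_eqE /= in nb; rewrite add0n (negbTE nb) scale0r.
  rewrite (toeplitz_exp0 p0 lt_dn) trmx0 mulmx0 big1 // => b _.
  rewrite add0n (_ : (b : nat) == n = false) ?scale0r //.
  by apply/negbTE/eqP => eb; have := ltn_ord b; lia.
rewrite -F0 addrC [LHS](_ : _ = F 0 + \sum_(a < d.+1) F a.+1); last first.
  congr (_ + _); apply: eq_bigr => a _; rewrite mulmx_sumr; apply: eq_bigr => b _.
  by rewrite -scalemxAr exprS toeplitzM !mulmxA addSn.
rewrite -(big_ord_recl _ (fun a => F a)) big_ord_recr /= FS addr0.
by apply: eq_bigr => a _; apply: eq_bigr => b _; rewrite eqSS.
Qed.

Lemma hankel_comp p q : p`_0 = 0 ->
  hankel (q \Po p) = \sum_(a < d.+1) \sum_(b < d.+1)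
    q`_(a + b).+1 *: (toeplitz (p ^+ a) *m hankel p *m (toeplitz (p ^+ b))^T).
Proof.
move=> p0; have -> : hankel (q \Po p) = \sum_(n < size q) q`_n *: hankel (p ^+ n).
  apply/matrixP => i j; rewrite comp_polyE !mxE summxE coef_sum.
  by apply: eq_bigr => n _; rewrite coefZ !mxE.
under eq_bigr do rewrite hankel_exp // scaler_sumr.
rewrite exchange_big; apply: eq_bigr => a _ /=.
under eq_bigr do rewrite scaler_sumr.
rewrite exchange_big; apply: eq_bigr => b _ /=.
under eq_bigr do rewrite scalerA.
rewrite -scaler_suml; congr (_ *: _).
case: (ltnP (a + b).+1 (size q)) => [lt_ab|le_ab].
  rewrite (bigD1 (Ordinal lt_ab)) //= eqxx mulr1 big1 ?addr0 // => n nab.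
  by rewrite eq_sym -val_eqE /= in nab; rewrite (negbTE nab) mulr0.
rewrite nth_default // big1 // => n _.
rewrite (gtn_eqF (leq_trans (ltn_ord n) le_ab)) mulr0 //.
Qed.

(** Diagonalizing the coefficient form of [q] turns the double sum of [hankel_comp] into a weighted
    sum of congruence transforms of [hankel p], from which semidefiniteness can be read off. *)
Lemma hankel_comp_ldl p q (e : 'rV[R]_d.+1) (L : 'M[R]_d.+1) : p`_0 = 0 ->
  hankel q = L *m diag_mx e *m L^T ->
  hankel (q \Po p) = \sum_m e 0 m *:
    ((\sum_a L a m *: toeplitz (p ^+ a)) *m hankel p *m
     (\sum_a L a m *: toeplitz (p ^+ a))^T).
Proof.
move=> p0 qE; rewrite hankel_comp //.
have coefq (a b : 'I_d.+1) : q`_(a + b).+1 = \sum_m e 0 m * (L a m * L b m).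
  have := congr1 (fun M : 'M[R]_d.+1 => M a b) qE; rewrite !mxE => ->.
  by apply: eq_bigr => m _; rewrite mul_mx_diag !mxE; ring.
under eq_bigr do under eq_bigr do rewrite coefq scaler_suml.
under eq_bigr do rewrite exchange_big /=.
rewrite exchange_big /=; apply: eq_bigr => m _.
rewrite linear_sum mulmx_suml mulmx_suml scaler_sumr; apply: eq_bigr => a _ /=.
rewrite mulmx_sumr scaler_sumr; apply: eq_bigr => b _.
rewrite linearZ /= -!scalemxAl -scalemxAr !scalerA; congr (_ *: _); ring.
Qed.

End HankelToeplitz.

(** * Positive semidefinite matrices *)

Section PositiveSemidefinite.
Variable R : realFieldType.

Definition psd n (M : 'M[R]_n) := forall u : 'rV[R]_n, 0 <= (u *m M *m u^T) 0 0.

Lemma psd_conj m n (K : 'M[R]_(m, n)) M : psd M -> psd (K *m M *m K^T).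
Proof.
by move=> psdM u; have := psdM (u *m K); rewrite trmx_mul !mulmxA.
Qed.

Lemma psdZ n c (M : 'M[R]_n) : 0 <= c -> psd M -> psd (c *: M).
Proof.
move=> c0 psdM u; rewrite -scalemxAr -scalemxAl mxE.
by apply: mulr_ge0 => //; exact: psdM.
Qed.

Lemma psd_sum n (I : finType) (F : I -> 'M[R]_n) :
  (forall i, psd (F i)) -> psd (\sum_i F i).
Proof.
move=> psdF u; rewrite mulmx_sumr mulmx_suml summxE.
by apply: sumr_ge0 => i _; exact: psdF.
Qed.

Lemma psd_diag n (c : 'rV[R]_n) : (forall i, 0 <= c 0 i) -> psd (diag_mx c).
Proof.
move=> c0 u; rewrite mul_mx_diag mxE; apply: sumr_ge0 => i _; rewrite !mxE.
by rewrite mulrAC -expr2; apply: mulr_ge0 => //; exact: sqr_ge0.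
Qed.

(** Along a line of direction [w] the quadratic form is affine; being bounded below, it has slope
    zero. *)
Lemma psd_isotropic n (M : 'M[R]_n) (w : 'rV[R]_n) : M^T = M -> psd M ->
  (w *m M *m w^T) 0 0 = 0 -> w *m M = 0.
Proof.
move=> symM psdM w0; apply/rowP => j; rewrite [RHS]mxE.
pose z : 'rV[R]_n := delta_mx 0 j.
have wz : (w *m M *m z^T) 0 0 = (w *m M) 0 j by rewrite trmx_delta -colE mxE.
have zw : (z *m M *m w^T) 0 0 = (w *m M) 0 j.
  rewrite -wz -[z *m M *m w^T]trmxK mxE !trmx_mul trmxK symM mulmxA //.
set s := (w *m M) 0 j in wz zw *.
apply/eqP; apply/negPn/negP => s0.
(* The multiple of [w] is chosen so that the form takes the value -1 at this vector. *)
have := psdM (z - (((z *m M *m z^T) 0 0 + 1) / (2 * s)) *: w).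
rewrite [(_ - _)^T]linearB /= [(_ *: w)^T]linearZ /= !mulmxBl !mulmxBr -!scalemxAl -!scalemxAr.
move: wz zw w0; 
move: (w *m M *m z^T) (z *m M *m w^T) (w *m M *m w^T) (z *m M *m z^T) => N1 N2 N3 N4.
move=> wz zw w0; rewrite !mxE wz zw w0 !mulr0 subr0 => ge0.
move: ge0; set t := (N4 0 0).
have -> : (t + 1) / (2 * s) * s = (t + 1) / 2 by field.
lra.
Qed.

(* Either some kernel vector has a nonzero last coordinate, or the last basis
   vector is orthogonal to the kernel, hence lies in the range. *)
Lemma psd_last_row n (M : 'M[R]_n.+1) : M^T = M -> psd M ->
  exists v : 'rV[R]_n.+1, exists c : R,
    v 0 ord_max = 1 /\ v *m M = c *: delta_mx 0 ord_max.
Proof.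
move=> symM psdM; pose e : 'rV[R]_n.+1 := delta_mx 0 ord_max.
have [/submxP[w eE]|] := boolP (e <= M)%MS.
  have wMw : (w *m M *m w^T) 0 0 = w 0 ord_max.
    by rewrite -eE /e -[w]trmxK trmxK -rowE !mxE.
  (* Otherwise [w] is isotropic, so that [e = w *m M] would vanish. *)
  have w0 : w 0 ord_max != 0.
    apply/eqP => w0; have := psd_isotropic symM psdM (etrans wMw w0).
    rewrite -eE => /rowP/(_ ord_max); rewrite !mxE !eqxx => /eqP.
    by rewrite oner_eq0.
  exists ((w 0 ord_max)^-1 *: w), (w 0 ord_max)^-1.
  by rewrite mxE mulVf // -scalemxAl -eE.
rewrite submxE => /eqP/eqP eC.
have [j ej] : exists j, (e *m cokermx M) 0 j != 0.
  by apply/existsP; apply: contraR eC => /existsPn z; apply/eqP/rowP => j;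
    rewrite [RHS]mxE; apply/eqP/negPn/z.
(* By symmetry of [M], a column of its cokernel is, transposed, a left kernel vector. *)
pose w : 'rV[R]_n.+1 := (col j (cokermx M))^T.
have wM : w *m M = 0.
  by rewrite /w -[X in _ *m X]symM -trmx_mul colE mulmxA mulmx_coker mul0mx trmx0.
have w0 : w 0 ord_max != 0 by move: ej; rewrite /e -rowE mxE [w 0 _]mxE [col _ _ _ _]mxE.
exists ((w 0 ord_max)^-1 *: w), 0.
by rewrite mxE mulVf // -scalemxAl wM scaler0 scale0r.
Qed.

End PositiveSemidefinite.

(** * Padé denominators as rows acting on Hankel matrices *)

Section PadeDenominator.
Variable R : realFieldType.
Implicit Types A B q : {poly R}.

(* [q] is a normalized denominator of the order [k] Padé approximant at 0 to
   any function with Taylor coefficients [A]. *)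
Definition pade_den (k : nat) A q :=
  [/\ (size q <= k.+1)%N, q`_0 = 1 &
      forall n, (k < n <= 2 * k)%N -> (q * A)`_n = 0].

(** Turns the Padé conditions into linear conditions on Hankel rows: as [q] has degree at most [k],
    the convolution at index [(k + j).+1] involves only Hankel entries of column [j]. *)
Lemma hankel_row d k q A (j : 'I_d.+1) : (size q <= k.+1)%N -> (k <= d)%N ->
  \sum_(i < d.+1) (if (i <= k)%N then q`_(k - i) else 0) * hankel d A i j =
  (q * A)`_(k + j).+1.
Proof.
move=> sq le_kd; rewrite coefM -addSn -(addnS k.+1 j) big_split_ord /=.
rewrite [X in _ + X]big1 ?addr0; last first.
  by move=> i _; rewrite nth_default ?mul0r // (leq_trans sq) ?leq_addr.
rewrite [RHS](reindex_inj rev_ord_inj) /=.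
rewrite -(sum_ord_leq (n := d.+1)
  (fun l => q`_(k.+1 - l.+1) * A`_(k.+1 + j - (k.+1 - l.+1)))) //.
apply: eq_bigr => l _; rewrite !mxE subSS; case: leqP => [le|]; last by rewrite mul0r.
by congr (_ * A`__); lia.
Qed.

Lemma hankel_sym d A : (hankel d A)^T = hankel d A.
Proof. by apply/matrixP => i j; rewrite !mxE addnC. Qed.

Lemma hankel_ldl d A (q : nat -> {poly R}) :
  (forall k, (k <= d)%N -> pade_den k A (q k)) ->
  exists L : 'M[R]_d.+1,
    hankel d A = L *m diag_mx (\row_k (q k * A)`_(2 * k).+1) *m L^T.
Proof.
move=> padeq.
pose V : 'M[R]_d.+1 := \matrix_(k, i) if (i <= k)%N then (q k)`_(k - i) else 0.
have VH k j : (V *m hankel d A) k j = (q k * A)`_(k + j).+1.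
  have le_kd : (k <= d)%N by rewrite -ltnS.
  have [sq _ _] := padeq k le_kd.
  by rewrite -(hankel_row A j sq le_kd) mxE; apply: eq_bigr => i _; rewrite mxE.
set D := diag_mx _.
have VHV : V *m hankel d A *m V^T = D.
  pose s k : R := (q k * A)`_(2 * k).+1.
  (* For [i <= j <= k] the entry [(k, i)] of [V *m hankel d A] is the coefficient [(k + i).+1] of
     [q k * A], which the Padé condition kills unless [i = k]. Symmetry gives the other half. *)
  have low (k j : 'I_d.+1) : (j <= k)%N ->
      (V *m hankel d A *m V^T) k j = if k == j then s k else 0.
    move=> le_jk; rewrite mxE.
    have le_kd : (k <= d)%N by rewrite -ltnS.
    have [_ _ qA] := padeq k le_kd.
    transitivity (\sum_(i < d.+1) if (i <= j)%N then
        (if i == k then s k else 0) * (q j)`_(j - i) else 0).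
      apply: eq_bigr => i _; rewrite VH !mxE; case: leqP => [le_ij|]; last by rewrite mulr0.
      congr (_ * _); case: (eqVneq i k) => [->|nik]; first by rewrite /s; congr (_`__); lia.
      apply: qA; have : (i < k)%N by rewrite ltn_neqAle nik (leq_trans le_ij).
      by lia.
    rewrite (bigD1 k) //= eqxx big1 => [|i nik]; last first.
      by rewrite (negbTE nik) mul0r if_same.
    rewrite addr0; case: (eqVneq k j) => [<-|nkj].
      by rewrite leqnn subnn; have [_ -> _] := padeq k le_kd; rewrite mulr1.
    by rewrite ifF //; apply/negbTE; rewrite -ltnNge ltn_neqAle eq_sym nkj.
  apply/matrixP => k j; case: (leqP j k) => [le_jk|/ltnW le_kj].
    rewrite low // !mxE; case: eqVneq => [->|//]; by rewrite mulr1n.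
  have -> : (V *m hankel d A *m V^T) k j = (V *m hankel d A *m V^T) j k.
    by rewrite -{1}[V *m _ *m _]trmxK [LHS]mxE !trmx_mul trmxK hankel_sym mulmxA.
  by rewrite low // !mxE eq_sym; case: eqVneq => [->|//]; rewrite mulr1n.
have unitV : V \in unitmx.
  rewrite unitmxE det_trig.
    rewrite big1 ?unitr1 // => k _; rewrite mxE leqnn subnn.
    by have [|_ -> _] := padeq k; first by rewrite -ltnS.
  by apply/is_trig_mxP => i j lt_ij; rewrite mxE leqNgt lt_ij.
exists (invmx V); rewrite -/D -VHV trmx_inv !mulmxA mulVmx // mul1mx -mulmxA.
by rewrite mulmxV ?unitmx_tr // mulmx1.
Qed.

Lemma psd_hankel d A a (q : nat -> {poly R}) :
  (forall k, (k <= d)%N -> pade_den k A (q k)) ->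
  (forall k, (k <= d)%N -> 0 <= (q k * A)`_(2 * k).+1 / a) ->
  psd (a^-1 *: hankel d A).
Proof.
move=> padeq ge0; have [L ->] := hankel_ldl padeq.
rewrite scalemxAl scalemxAr; apply: psd_conj.
rewrite -linearZ; apply: psd_diag => k; rewrite !mxE mulrC.
by apply: ge0; rewrite -ltnS.
Qed.

(** The diagonal of the factorization for [B], divided by [b], gives nonnegative weights; they
    multiply congruence transforms of the semidefinite [a^-1 *: hankel d A]. *)
Lemma psd_hankel_comp d A B a b (qA qB : nat -> {poly R}) : A`_0 = 0 ->
  (forall k, (k <= d)%N -> pade_den k A (qA k)) ->
  (forall k, (k <= d)%N -> pade_den k B (qB k)) ->
  (forall k, (k <= d)%N -> 0 <= (qA k * A)`_(2 * k).+1 / a) ->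
  (forall k, (k <= d)%N -> 0 <= (qB k * B)`_(2 * k).+1 / b) ->
  psd ((a * b)^-1 *: hankel d (B \Po A)).
Proof.
move=> A0 padeA padeB geA geB; have [L /(hankel_comp_ldl A0) ->] := hankel_ldl padeB.
rewrite scaler_sumr; apply: psd_sum => m.
rewrite scalerA mxE mulrC invfM [a^-1 * _]mulrC mulrA -scalerA.
apply: psdZ; first by apply: geB; rewrite -ltnS.
by rewrite scalemxAl scalemxAr; apply: psd_conj; exact: psd_hankel geA.
Qed.

(** The vector of [psd_last_row], read backwards, is the denominator: its last entry 1 is the
    constant coefficient, and the vanishing of all columns but the last gives the conditions in
    degrees [d.+1] to [2 * d]. *)
Lemma pade_den_of_psd d A c : c != 0 -> psd (c *: hankel d A) ->
  exists q, pade_den d A q.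
Proof.
move=> c0 psdH.
have symH : (c *: hankel d A)^T = c *: hankel d A by rewrite linearZ /= hankel_sym.
have [v [s [v1 vH]]] := psd_last_row symH psdH.
pose q := \poly_(i < d.+1) v 0 (inord (d - i)).
have sq : (size q <= d.+1)%N by exact: size_poly.
exists q; split=> //.
  rewrite coef_poly /= subn0 -v1; congr (v 0 _); apply/val_inj.
  by rewrite /= inordK.
move=> n /andP[lt_dn le_n2d].
have lt_j : (n - d.+1 < d.+1)%N by lia.
have -> : n = (d + Ordinal lt_j).+1 by rewrite /=; lia.
rewrite -(hankel_row _ _ sq) //.
have := congr1 (fun M : 'rV[R]_d.+1 => M 0 (Ordinal lt_j)) vH.
rewrite -scalemxAr !mxE /= -val_eqE /= (_ : (_ == d) = false); last first.
  by apply/negbTE/eqP; lia.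
rewrite mulr0 => /eqP; rewrite mulf_eq0 (negbTE c0) /= => /eqP vH0.
rewrite -[RHS]vH0; apply: eq_bigr => i _; congr (_ * _).
have le_id : (i <= d)%N by rewrite -ltnS.
rewrite le_id coef_poly ifT; last by lia.
by rewrite subKn // inord_val.
Qed.

Lemma pade_den_psd_ge0 d A c q : psd (c *: hankel d A) -> pade_den d A q ->
  0 <= c * (q * A)`_(2 * d).+1.
Proof.
move=> psdH [sq q0 qA].
pose v : 'rV[R]_d.+1 := \row_i q`_(d - i).
have vH (j : 'I_d.+1) : (v *m hankel d A) 0 j = (q * A)`_(d + j).+1.
  rewrite -(hankel_row _ _ sq) // mxE; apply: eq_bigr => i _.
  by rewrite mxE -ltnS ltn_ord.
have := psdH v; rewrite -scalemxAr -scalemxAl mxE [X in _ * X]mxE.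
rewrite (bigD1 ord_max) //= big1 ?addr0 => [|j nj].
  by rewrite vH !mxE subnn q0 mulr1 /= addnn -mul2n.
rewrite vH qA ?mul0r //; rewrite -val_eqE /= in nj.
by have := ltn_ord j; lia.
Qed.

End PadeDenominator.

(** * Effect of changing the top Taylor coefficient *)

Section Perturbation.
Variable R : realFieldType.
Implicit Types A B C P Q U q : {poly R}.

(** The congruence of [A] and [P + s *: 'X^N] modulo ['X^N.+1]. *)
Definition agree (N : nat) (s : R) A P :=
  (forall n, (n < N)%N -> A`_n = P`_n) /\ A`_N = P`_N + s.

Lemma agreeP N s A P :
  agree N s A P <-> exists2 U, A = P + 'X^N * U & U`_0 = s.
Proof.
split=> [[eqlt eqN]|[U -> <-]]; last first.
  split=> [n lt_nN|]; rewrite coefD coefXnM ?lt_nN ?addr0 //.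
  by rewrite ltnn subnn.
exists (drop_poly N (A - P)); last first.
  by rewrite coef_drop_poly add0n coefB eqN addrAC subrr add0r.
rewrite mulrC -[A in LHS](subrK P) addrC -{1}(poly_take_drop N (A - P)).
rewrite [take_poly N _](_ : _ = 0) ?add0r //; apply/polyP => i.
rewrite coef_take_poly coef0 coefB; case: ltnP => // lt_iN.
by rewrite eqlt // subrr.
Qed.

Lemma agree_trans N s t A P Q : agree N s A P -> agree N t P Q -> agree N (t + s) A Q.
Proof.
move=> [AP APN] [PQ PQN]; split=> [n lt_nN|]; first by rewrite AP // PQ.
by rewrite APN PQN addrA.
Qed.

Lemma agree_mull N s A P q : agree N s A P -> agree N (q`_0 * s) (q * A) (q * P).
Proof.
move=> /agreeP[U -> <-]; apply/agreeP; exists (q * U); last first.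
  by rewrite coefM big_ord1 subnn.
by rewrite mulrDr mulrCA.
Qed.

Lemma comp_poly_taylor1 B P U : exists W,
  B \Po (P + U) = B \Po P + U * (B^`() \Po P) + U ^+ 2 * W.
Proof.
elim/poly_ind: B => [|B c [W IH]].
  by exists 0; rewrite deriv0 !comp_poly0 !mulr0 !addr0.
exists ((B^`() \Po P) + W * (P + U)).
rewrite derivD derivC addr0 derivM derivX mulr1.
rewrite !comp_polyD !comp_polyM !comp_polyX !comp_polyC IH; ring.
Qed.

Lemma coef0_comp A B : A`_0 = 0 -> (B \Po A)`_0 = B`_0.
Proof.
by move=> A0; rewrite -horner_coef0 horner_comp horner_coef0 A0 horner_coef0.
Qed.

(** First order Taylor expansion of [B] around [P]; the quadratic remainder has order at least
    [2 * N], which exceeds [N]. *)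
Lemma agree_comp N s A P B : (0 < N)%N -> P`_0 = 0 -> agree N s A P ->
  agree N (s * B`_1) (B \Po A) (B \Po P).
Proof.
move=> N0 P0 /agreeP[U -> <-]; have [W ->] := comp_poly_taylor1 B P ('X^N * U).
apply/agreeP; exists (U * (B^`() \Po P) + 'X^N * (U ^+ 2 * W)); first by ring.
rewrite coefD coefXnM N0 addr0 coefM big_ord1 subnn coef0_comp //.
by rewrite coef_deriv.
Qed.

Lemma agree_comp_left N t A B C : A`_0 = 0 -> agree N t B C ->
  agree N (t * A`_1 ^+ N) (B \Po A) (C \Po A).
Proof.
move=> A0 /agreeP[U -> <-]; rewrite comp_polyD comp_polyM comp_Xn_poly.
split=> [n lt_nN|]; rewrite coefD; last first.
  congr (_ + _); rewrite coefM big_ord_recr /= big1 ?add0r; last first.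
    by move=> i _; rewrite coef_exp_lt ?mul0r.
  by rewrite subnn coef_exp_diag // coef0_comp // mulrC.
rewrite coefM big1 ?addr0 // => i _; rewrite coef_exp_lt ?mul0r //.
by apply: leq_trans lt_nN; rewrite ltnS -ltnS.
Qed.

Lemma agree_sub_monomial N s A : agree N s A (A - s *: 'X^N).
Proof.
apply/agreeP; exists s%:P; last by rewrite coefC.
by rewrite -mul_polyC [_ * s%:P]mulrC subrK.
Qed.

(** The conditions of order [k <= d] stop at degree [2 * d], just below the perturbed
    coefficient. *)
Lemma agree_pade_den d s A P k q : agree (2 * d).+1 s A P -> (k <= d)%N ->
  pade_den k A q <-> pade_den k P q.
Proof.
move=> AP le_kd; have [qAP _] := agree_mull q AP.
split=> -[sq q0 qA]; split=> // n nk; first by rewrite -qAP ?qA //; lia.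
by rewrite qAP ?qA //; lia.
Qed.

(* The top coefficients of [A] and [B] enter the order [d] quantities affinely;
   removing [s_d] from them makes both Hankel forms semidefinite. *)
Lemma pade_den_comp d A B (qA qB : nat -> {poly R}) : (0 < d)%N ->
  A`_0 = 0 -> A`_1 != 0 -> B`_1 != 0 ->
  (forall k, (0 < k <= d)%N -> pade_den k A (qA k)) ->
  (forall k, (0 < k <= d)%N -> pade_den k B (qB k)) ->
  (forall k, (0 < k < d)%N -> 0 <= (qA k * A)`_(2 * k).+1 / A`_1) ->
  (forall k, (0 < k < d)%N -> 0 <= (qB k * B)`_(2 * k).+1 / B`_1) ->
  (exists q, pade_den d (B \Po A) q) /\
  (forall q, pade_den d (B \Po A) q ->
    (qB d * B)`_(2 * d).+1 / B`_1 * A`_1 ^+ (2 * d) +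
    (qA d * A)`_(2 * d).+1 / A`_1
    <= (q * (B \Po A))`_(2 * d).+1 / (A`_1 * B`_1)).
Proof.
move=> d0 A0 A1 B1 padeA padeB geA geB.
set s := (qA d * A)`_(2 * d).+1; set t := (qB d * B)`_(2 * d).+1.
pose N := (2 * d).+1.
have N1 : (1 < N)%N by rewrite /N; lia.
pose A' := A - s *: 'X^N; pose B' := B - t *: 'X^N.
have AA' : agree N s A A' by exact: agree_sub_monomial.
have BB' : agree N t B B' by exact: agree_sub_monomial.
have A'0 : A'`_0 = 0 by rewrite -AA'.1.
have A'1 : A'`_1 = A`_1 by rewrite AA'.1.
have B'1 : B'`_1 = B`_1 by rewrite BB'.1.
(* The Hankel factorization also has a row of order 0; its denominator is 1, with diagonal entry the
   linear coefficient, so the quotient is 1. *)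
pose q0 (q : nat -> {poly R}) k := if k is 0 then 1 else q k.
have pade0 P : pade_den 0 P 1.
  by split=> [||n]; [rewrite size_poly1 | rewrite coef1 | lia].
have padeP P P' u (q : nat -> {poly R}) : agree N u P P' ->
    (forall k, (0 < k <= d)%N -> pade_den k P (q k)) ->
    forall k, (k <= d)%N -> pade_den k P' (q0 q k).
  move=> PP' padeq [|k] le_kd; first exact: pade0.
  by apply/(agree_pade_den _ PP' le_kd); apply: padeq.
have geP P P' (q : nat -> {poly R}) : agree N (q d * P)`_N P P' -> P'`_1 = P`_1 -> P`_1 != 0 ->
    (forall k, (0 < k <= d)%N -> pade_den k P (q k)) ->
    (forall k, (0 < k < d)%N -> 0 <= (q k * P)`_(2 * k).+1 / P`_1) ->
    forall k, (k <= d)%N -> 0 <= (q0 q k * P')`_(2 * k).+1 / P`_1.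
  move=> PP' P1 P1n padeq ge [|k] le_kd; first by rewrite mul1r P1 divff.
  have [lt qN] := agree_mull (q k.+1) PP'.
  have [_ qk0 _] := padeq k.+1 le_kd.
  (* At order [d] the subtraction makes the diagonal entry exactly 0; at lower orders the entry lies
     below degree [N] and is unchanged. *)
  move: le_kd; rewrite leq_eqVlt => /predU1P[ek|lt_kd] /=.
    move: qN; rewrite qk0 mul1r ek -/N => /eqP.
    by rewrite -subr_eq subrr => /eqP <-; rewrite mul0r.
  by rewrite -lt ?ge //; rewrite /N; lia.
have psdC : psd ((A`_1 * B`_1)^-1 *: hankel d (B' \Po A')).
  apply: (psd_hankel_comp (qA := q0 qA) (qB := q0 qB)) => //.
  - exact: padeP AA' padeA.
  - exact: padeP BB' padeB.
  - exact: geP.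
  - exact: geP.
(* Replace the inner series first, then the outer one; divided by [A]_1 * B[_1], the total change is
   the lower bound sought. *)
have CC' : agree N (t * A`_1 ^+ N + s * B`_1) (B \Po A) (B' \Po A').
  apply: agree_trans (agree_comp (P := A') B _ _ AA') _ => //.
  by rewrite -A'1; apply: agree_comp_left.
have AB1 : A`_1 * B`_1 != 0 by rewrite mulf_neq0.
split.
  have [q padeq] := pade_den_of_psd (invr_neq0 AB1) psdC.
  by exists q; apply/(agree_pade_den _ CC').
move=> q /(agree_pade_den _ CC' (leqnn d)) padeq.
have := pade_den_psd_ge0 psdC padeq; have [_ q00 _] := padeq.
have [_ ->] := agree_mull q CC'; rewrite q00 mul1r -/N => ge0.
have -> : t / B`_1 * A`_1 ^+ (2 * d) + s / A`_1 =
    (t * A`_1 ^+ N + s * B`_1) / (A`_1 * B`_1).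
  by rewrite /N exprS; field; rewrite A1 B1.
by rewrite [X in _ <= X]mulrDl lerDr mulrC.
Qed.

End Perturbation.

(** * Calculus of Taylor polynomials of finitely differentiable functions *)

Section Jets.
Variable R : realType.
Implicit Types (f g h k : R -> R) (x y z : R) (P Q A B : {poly R}).

(* [P] is a Taylor polynomial of order [n] of [h] at [y], in the variable
   [z - y]; its coefficients of index greater than [n] are irrelevant. *)
Fixpoint jet n h y P : Prop :=
  h y = P`_0 /\
  if n is m.+1 then
    [/\ derivable h y 1, ((0 < m)%N -> \forall z \near y, derivable h z 1) &
        jet m h^`() y P^`()]
  else True.

Lemma n_differentiableS n h y : n_differentiable n.+1 h y <->
  [/\ derivable h y 1, ((0 < n)%N -> \forall z \near y, derivable h z 1) &
      n_differentiable n h^`() y].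
Proof.
split=> [[dy dz]|[dy dz [dy' dz']]]; split.
- exact: (dy 0).
- by case: n dy dz => // n _ dz _; apply: (dz 0).
- split=> j lt_jn; first by rewrite -derive1Sn; apply: dy.
  by rewrite -derive1Sn; apply: dz.
- case=> [_|j lt_jn]; first exact: dy.
  by rewrite derive1Sn; exact: dy' lt_jn.
- by case=> [n0|j lt_jn]; [exact: dz|rewrite derive1Sn; apply: dz'].
Qed.

(** The recursive form suits inductions through the product and chain rules; this form connects it
    with iterated derivatives. *)
Lemma jetP n h y P : jet n h y P <-> n_differentiable n h y /\
  (forall j, (j <= n)%N -> h^`(j) y = P`_j *+ j`!).
Proof.
elim: n h P => [|n IHn] h P /=.
  split=> [[hy _]|[_ /(_ 0 isT)]]; last by [].
  by split=> // -[|//] _; exact: hy.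
split=> [[hy [dy dz /IHn[dh' eh']]]|[/n_differentiableS[dy dz dh'] eh]].
  split; first exact/n_differentiableS.
  case=> [_|j lt_jn]; first exact: hy.
  by rewrite derive1Sn eh' // coef_deriv -mulrnA factS.
split; first exact: (eh 0 isT).
split=> //; apply/IHn; split=> // j le_jn.
by rewrite -derive1Sn eh // coef_deriv -mulrnA factS.
Qed.

Lemma jet_uniq n h y P Q : jet n h y P -> jet n h y Q ->
  forall j, (j <= n)%N -> P`_j = Q`_j.
Proof.
move=> /jetP[_ eP] /jetP[_ eQ] j le_jn.
have := eP j le_jn; rewrite eQ // => /esym/eqP.
by rewrite eqr_pMn2r ?fact_gt0 // => /eqP.
Qed.

Lemma jet_coef n h y P Q : (forall j, (j <= n)%N -> P`_j = Q`_j) ->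
  jet n h y P -> jet n h y Q.
Proof.
move=> PQ /jetP[dh eh]; apply/jetP; split=> // j le_jn.
by rewrite eh // PQ.
Qed.

Lemma jet_le m n h y P : (m <= n)%N -> jet n h y P -> jet m h y P.
Proof.
move=> le_mn /jetP[[dy dz] eh]; apply/jetP; split; last first.
  by move=> j le_jm; apply: eh; apply: leq_trans le_mn.
by split=> j lt_jm; [apply: dy|apply: dz]; apply: leq_trans le_mn.
Qed.

Lemma n_differentiable_le m n h y : (m <= n)%N ->
  n_differentiable n h y -> n_differentiable m h y.
Proof.
by move=> le_mn [dy dz]; split=> j lt_jm; [apply: dy|apply: dz]; apply: leq_trans le_mn.
Qed.

Definition taylor n h y : {poly R} := \poly_(j < n.+1) (h^`(j)%classic y / j`!%:R).

Lemma jet_taylor n h y : n_differentiable n h y -> jet n h y (taylor n h y).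
Proof.
move=> dh; apply/jetP; split=> // j le_jn.
by rewrite coef_poly ltnS le_jn -[RHS]mulr_natr divfK // pnatr_eq0 -lt0n fact_gt0.
Qed.

(** Equality near [y] is asked only for positive [n]: in the inductions below, the formula for a
    derivative is available at the last order only at [y] itself. *)
Lemma jet_near n h k y P : h y = k y ->
  ((0 < n)%N -> \forall z \near y, h z = k z) -> jet n h y P -> jet n k y P.
Proof.
elim: n h k P => [|n IHn] h k P hk /=; first by rewrite hk.
move=> /(_ isT) hkz [hy [dy dz dh']]; split; first by rewrite -hk.
have dkz : \forall z \near y, h^`() z = k^`() z.
  move: hkz => /near_join; apply: filterS => z hkz.
  by rewrite !derive1E; exact: near_eq_derive.
split.
- exact: near_eq_derivable dy.
- move=> n0; move: hkz => /near_join hkz; near=> z.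
  apply: (@near_eq_derivable _ _ _ h); last by near: z; apply: dz.
  by near: z.
- by apply: IHn dh' => //; exact: nbhs_singleton dkz.
Unshelve. all: by end_near. Qed.

Lemma jetD n h k y P Q : jet n h y P -> jet n k y Q -> jet n (h \+ k) y (P + Q).
Proof.
elim: n h k P Q => [|n IHn] h k P Q /=.
  by move=> [-> _] [-> _]; rewrite coefD.
move=> [hy [dhy dhz dh']] [ky [dky dkz dk']].
split; first by rewrite hy ky coefD.
have derD z : derivable h z 1 -> derivable k z 1 ->
    (h^`() \+ k^`()) z = (h \+ k)^`() z.
  by move=> dh dk; rewrite [LHS]/= !derive1E (deriveD dh dk).
split; first exact: (derivableD dhy dky).
- move=> n0; apply: filterS2 (dhz n0) (dkz n0) => z dh dk.
  exact: (derivableD dh dk).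
rewrite derivD; apply: jet_near (IHn _ _ _ _ dh' dk'); first exact: derD dhy dky.
by move=> n0; apply: filterS2 (dhz n0) (dkz n0) => z; exact: derD.
Qed.

Lemma jetM n h k y P Q : jet n h y P -> jet n k y Q -> jet n (h \* k) y (P * Q).
Proof.
elim: n h k P Q => [|n IHn] h k P Q.
  by move=> [hy _] [ky _]; split=> //=; rewrite hy ky coefM big_ord1.
move=> hP kQ; have [hy [dhy dhz dh']] := hP; have [ky [dky dkz dk']] := kQ.
have derM z : derivable h z 1 -> derivable k z 1 ->
    (h^`() \* k \+ h \* k^`()) z = (h \* k)^`() z.
  by move=> dh dk; rewrite [LHS]/= !derive1E (deriveM dh dk) addrC /GRing.scale /= [k z * _]mulrC.
split; first by rewrite /= hy ky coefM big_ord1.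
split; first exact: (derivableM dhy dky).
- move=> n0; apply: filterS2 (dhz n0) (dkz n0) => z dh dk.
  exact: (derivableM dh dk).
rewrite derivM; apply: (@jet_near _ (h^`() \* k \+ h \* k^`())).
- exact: derM dhy dky.
- by move=> n0; apply: filterS2 (dhz n0) (dkz n0) => z; exact: derM.
- apply: jetD; first exact: IHn dh' (jet_le (leqnSn n) kQ).
  exact: IHn (jet_le (leqnSn n) hP) dk'.
Qed.

Lemma derivable_continuous h y : derivable h y 1 -> {for y, continuous h}.
Proof. by move=> /derivable1_diffP; exact: differentiable_continuous. Qed.

(** [B] is a polynomial in the distance to [f x], hence the removal of the constant term of [A].
    Induction by the chain rule and [jetM]. *)
Lemma jet_comp n f g x A B : jet n f x A -> jet n g (f x) B ->
  jet n (g \o f) x (B \Po (A - (A`_0)%:P)).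
Proof.
have A00 : (A - (A`_0)%:P)`_0 = 0 by rewrite coefB coefC eqxx subrr.
elim: n g B => [|n IHn] g B.
  by move=> _ [gy _]; split=> //=; rewrite gy coef0_comp.
move=> fA gB; have [fx [dfx dfz df']] := fA; have [gy [dgy dgz dg']] := gB.
have derC z : derivable f z 1 -> derivable g (f z) 1 ->
    ((g^`() \o f) \* f^`()) z = (g \o f)^`() z.
  by move=> df dg; rewrite [RHS](derive1_comp df dg).
split; first by rewrite /= gy coef0_comp.
have dgfz : (0 < n)%N -> \forall z \near x, derivable g (f z) 1.
  move=> n0.
  have := derivable_continuous dfx (dgz n0).
  rewrite nbhs_filterE => H; exact H.
have derivable_comp z : derivable f z 1 -> derivable g (f z) 1 -> derivable (g \o f) z 1.
  move=> /derivable1_diffP df /derivable1_diffP dg; apply/derivable1_diffP.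
  exact: differentiable_comp.
split; first exact: derivable_comp dfx dgy.
- by move=> n0; apply: filterS2 (dfz n0) (dgfz n0) => z; exact: derivable_comp.
rewrite deriv_comp derivB derivC subr0.
apply: (@jet_near _ ((g^`() \o f) \* f^`())).
- exact: derC dfx dgy.
- by move=> n0; apply: filterS2 (dfz n0) (dgfz n0) => z; exact: derC.
- by apply: jetM df'; exact: IHn (jet_le (leqnSn n) fA) dg'.
Qed.

Lemma jet_horner n (p : {poly R}) y : jet n (horner p) y (p \Po ('X + y%:P)).
Proof.
elim: n p => [|n IHn] p.
  by split=> //; rewrite -horner_coef0 horner_comp !hornerE.
split; first by rewrite -horner_coef0 horner_comp !hornerE.
split; first exact: derivable_horner.
- by move=> _; near=> z; exact: derivable_horner.
- by rewrite -derivE deriv_comp derivD derivX derivC addr0 mulr1; exact: IHn.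
Unshelve. all: by end_near. Qed.

Lemma n_differentiable_near n h k y : h y = k y ->
  ((0 < n)%N -> \forall z \near y, h z = k z) ->
  n_differentiable n h y -> n_differentiable n k y.
Proof.
by move=> hk hkz dh; have /jetP[] := jet_near hk hkz (jet_taylor dh).
Qed.

End Jets.

(** * Smoothness of rational maps and of their local inverses *)

Section RationalMaps.
Variable R : realType.
Implicit Types (f F h phi : R -> R) (x y z w : R) (p q u v : {poly R}).

Lemma horner_near_neq0 p phi w : {for w, continuous phi} ->
  p.[phi w] != 0 -> \forall t \near w, p.[phi t] != 0.
Proof.
move=> phic pw.
have pc : {for w, continuous (horner p \o phi)}.
  by apply: continuous_comp => //; exact: continuous_horner.
by move/cvgr_neq0: pc; apply.
Qed.

Lemma is_derive_ratmap (r : {poly R} * {poly R}) z : r.2.[z] != 0 ->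
  is_derive z 1 (ratmap_fun r)
    ((r.1^`() * r.2 - r.1 * r.2^`()).[z] / (r.2 ^+ 2).[z]).
Proof.
move=> v0; have dp p : is_derive z 1 (horner p) p^`().[z].
  by apply: DeriveDef (@derivable_horner R p z) _; rewrite -derive1E derivE.
have dV := is_deriveV v0 (dp r.2).
apply: is_derive_eq (is_deriveM (dp r.1) dV) _.
by rewrite !hornerE /GRing.scale /=; field.
Qed.

(** If [phi] solves an autonomous equation with rational right-hand side [a], the derivative of
    [r \o phi] is again a rational map composed with [phi], so induction applies. This covers both
    the identity and local inverses of rational maps. *)
Lemma n_differentiable_ratmap_comp n phi w (a r : {poly R} * {poly R}) :
  (\forall t \near w, is_derive (t : R) 1 phi (ratmap_fun a (phi t))) ->
  a.2.[phi w] != 0 -> r.2.[phi w] != 0 ->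
  n_differentiable n (ratmap_fun r \o phi) w.
Proof.
move=> dphi a0; elim: n r => [|n IHn] r r0; first by split.
have phic : {for w, continuous phi}.
  by apply: derivable_continuous; have [] := nbhs_singleton dphi.
(* The rational map [r' * a], not reduced to lowest terms. *)
pose s := ((r.1^`() * r.2 - r.1 * r.2^`()) * a.1, r.2 ^+ 2 * a.2).
have dr : \forall t \near w,
    is_derive (t : R) 1 (ratmap_fun r \o phi) (ratmap_fun s (phi t)).
  near=> t.
  have r0t : r.2.[phi t] != 0 by near: t; exact: horner_near_neq0.
  have a0t : a.2.[phi t] != 0 by near: t; exact: horner_near_neq0.
  have dt : is_derive (t : R) 1 phi (ratmap_fun a (phi t)) by near: t.
  apply: is_derive_eq (is_derive1_comp (is_derive_ratmap r0t) dt) _.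
  by rewrite /ratmap_fun /s /= [in RHS]hornerM [in RHS]hornerM invfM mulrACA.
have dsr : \forall t \near w, (ratmap_fun s \o phi) t = (ratmap_fun r \o phi)^`() t.
  by apply: filterS dr => t [_ dt]; rewrite derive1E dt.
apply/n_differentiableS; split.
- by have [] := nbhs_singleton dr.
- by move=> _; apply: filterS dr => t [].
apply: (@n_differentiable_near _ _ (ratmap_fun s \o phi)) => //.
  exact: nbhs_singleton dsr.
by apply: IHn; rewrite /s /= !hornerM -expr2 mulf_neq0 ?expf_neq0.
Unshelve. all: by end_near. Qed.

Lemma n_differentiable_ratmap n (r : {poly R} * {poly R}) y : r.2.[y] != 0 ->
  n_differentiable n (ratmap_fun r) y.
Proof.
move=> r0; apply: (@n_differentiable_ratmap_comp n id y (1, 1) r) => //.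
  by near=> t; apply: is_derive_eq; rewrite /ratmap_fun /= !hornerE ?invr1 ?mulr1.
by rewrite hornerE oner_neq0.
Unshelve. all: by end_near. Qed.

(** By the mean value theorem, two equal values would force a zero of [F'] in between. *)
Lemma near_injective F (F' : R -> R) y :
  (\forall z \near y, is_derive (z : R) 1 F (F' z)) ->
  (\forall z \near y, F' z != 0) ->
  exists2 e : R, 0 < e & forall z1 z2,
    ball y e z1 -> ball y e z2 -> F z1 = F z2 -> z1 = z2.
Proof.
move=> dF F'0.
have [e /= e0 He] : \forall z \near y, is_derive (z : R) 1 F (F' z) /\ F' z != 0.
  by apply: filterI.
have lt_neq z1 z2 : ball y e z1 -> ball y e z2 -> z1 < z2 -> F z1 <> F z2.
  move=> b1 b2 lt12 eF.
  have inb z : z \in `[z1, z2]%R -> ball y e z.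
    rewrite in_itv /= => /andP[l1 l2]; move: b1 b2.
    rewrite /ball /= !ltr_distlC => /andP[? ?] /andP[? ?].
    by apply/andP; split; [apply: lt_le_trans l1|apply: le_lt_trans l2 _].
  have [||c c12] := @MVT R F F' z1 z2 lt12.
  - by move=> z z12; have [] := He z (inb z (subset_itv_oo_cc z12)).
  - apply: derivable_within_continuous => z z12.
    by have [[]] := He z (inb z z12).
  have [_ c0] := He c (inb c (subset_itv_oo_cc c12)).
  rewrite eF subrr => /esym/eqP; rewrite mulf_eq0 (negbTE c0) /= subr_eq0.
  by rewrite gt_eqF.
exists e => // z1 z2 b1 b2 eF.
by case: (ltgtP z1 z2) => // lt; [have := lt_neq _ _ b1 b2 lt|
  have := lt_neq _ _ b2 b1 lt]; rewrite eF.
Qed.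

(** [local_inverse] is a choice with a default, so an inverse has to be exhibited: it picks
    preimages in a ball of injectivity, and continuity of [F] makes it a right inverse near [F y] as
    well. *)
Lemma local_inverseP F (F' : R -> R) y :
  (\forall z \near y, is_derive (z : R) 1 F (F' z)) ->
  (\forall z \near y, F' z != 0) ->
  is_local_inverse F y (local_inverse F y).
Proof.
move=> dF F'0; apply: xgetPex.
have [e e0 Finj] := near_injective dF F'0.
pose phi w := xget y [set z | ball y e z /\ F z = w].
have phiK z : ball y e z -> phi (F z) = z.
  move=> bz; have [b' eF] : [set t | ball y e t /\ F t = F z] (phi (F z)).
    by apply: xgetPex; exists z.
  by apply: Finj.
have near_phiK : {near y, cancel F phi}.
  by exists e => // z; exact: phiK.
exists phi; split.
- by apply: phiK; exact: ballxx.
- exact: near_phiK.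
- have [|_ //] := near_can_continuousAcan_sym near_phiK.
  by apply: filterS dF => z [/derivable_continuous].
Qed.

Lemma is_derive_local_inverse F (F' : R -> R) y phi :
  (\forall z \near y, is_derive (z : R) 1 F (F' z)) ->
  (\forall z \near y, F' z != 0) ->
  is_local_inverse F y phi ->
  \forall w \near F y, is_derive (w : R) 1 phi (F' (phi w))^-1.
Proof.
move=> dF F'0 [phiy phiK Fphi].
have cF : \forall z \near y, {for z, continuous F}.
  by apply: filterS dF => z [/derivable_continuous].
have [cphi _] := near_can_continuousAcan_sym phiK cF.
have phic : {for F y, continuous phi} by exact: nbhs_singleton cphi.
have nearphi (P : R -> Prop) : (\forall z \near y, P z) -> \forall w \near F y, P (phi w).
  by move=> nP; apply: phic; rewrite phiy.
near=> w; rewrite -[w in is_derive w](_ : F (phi w) = w); last by near: w.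
apply: is_derive_inverse.
- by near: w; apply: (nearphi (fun z => {near z, cancel F phi})); exact: near_join.
- near: w; apply: (nearphi (fun z => \forall t \near z, {for t, continuous F})).
  exact: near_join.
- by near: w; exact: (nearphi (fun z => is_derive (z : R) 1 F (F' z))).
- by near: w; exact: (nearphi (fun z => F' z != 0)).
Unshelve. all: by end_near. Qed.

End RationalMaps.

(** * Padé approximants and Schwarzian derivatives in terms of Taylor coefficients *)

Section PadeJets.
Variable R : realType.
Implicit Types (f g h : R -> R) (x y z : R) (p q u v A B P Q : {poly R}).

Lemma comp_shift p y : (p \Po ('X + y%:P)) \Po ('X - y%:P) = p.
Proof.
by rewrite -comp_polyA comp_polyD comp_polyX comp_polyC subrK comp_polyXr.
Qed.

Lemma comp_unshift p y : (p \Po ('X - y%:P)) \Po ('X + y%:P) = p.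
Proof. by have := comp_shift p (- y); rewrite polyCN opprK. Qed.

Lemma size_comp_shift p y : size (p \Po ('X + y%:P)) = size p.
Proof. by rewrite -[y]opprK polyCN size_comp_poly2 ?size_XsubC. Qed.

Lemma coef0_shift p y : (p \Po ('X + y%:P))`_0 = p.[y].
Proof. by rewrite -horner_coef0 horner_comp !hornerE. Qed.

Lemma coef_mul_cancel n q P Q : q`_0 != 0 ->
  (forall j, (j <= n)%N -> (q * P)`_j = (q * Q)`_j) ->
  forall j, (j <= n)%N -> P`_j = Q`_j.
Proof.
move=> q0 eqPQ; elim/ltn_ind=> j IHj le_jn.
have := eqPQ j le_jn; rewrite !coefM !big_ord_recl /= !subn0.
rewrite [X in _ + X = _](eq_bigr (fun i : 'I_j => q`_(bump 0 i) * Q`_(j - bump 0 i))).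
  by move=> /addIr /(mulfI q0).
by move=> i _; rewrite IHj //; rewrite /bump; have := ltn_ord i; lia.
Qed.

(** The Taylor polynomial of a quotient is described by its product with the denominator, so no
    power series inverse is formed. *)
Lemma ratmap_jet n (r : {poly R} * {poly R}) y : r.2.[y] != 0 ->
  exists2 P, jet n (ratmap_fun r) y P & forall j, (j <= n)%N ->
    ((r.2 \Po ('X + y%:P)) * P)`_j = (r.1 \Po ('X + y%:P))`_j.
Proof.
move=> r0; have jP := jet_taylor (n_differentiable_ratmap n r0).
exists (taylor n (ratmap_fun r) y) => //.
apply: jet_uniq (jetM (jet_horner n r.2 y) jP) _.
have near_r0 : \forall z \near y, r.2.[z] != 0.
  by apply: (@horner_near_neq0 _ r.2 id).
apply: jet_near (jet_horner n r.1 y).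
  by rewrite /ratmap_fun /= mulrC divfK.
move=> _; apply: filterS near_r0 => z z0.
by rewrite /ratmap_fun /= mulrC divfK.
Qed.

(** Supplies the lowest terms demanded by [is_pade]: the gcd divides [q], so it has no zero near [y]
    and cancels there. *)
Lemma is_ratmap_reduce p q y : q.[y] != 0 -> exists r : {poly R} * {poly R},
  [/\ is_ratmap r, (ratmap_degree r <= maxn (size p).-1 (size q).-1)%N,
      r.2.[y] != 0 & \forall z \near y, ratmap_fun r z = ratmap_fun (p, q) z].
Proof.
move=> qy; have q0 : q != 0 by apply: contraNneq qy => ->; rewrite horner0.
pose g := gcdp p q; have g0 : g != 0 by rewrite gcdp_eq0 negb_and q0 orbT.
have pE : p = p %/ g * g by rewrite divpK ?dvdp_gcdl.
have qE : q = q %/ g * g by rewrite divpK ?dvdp_gcdr.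
exists (p %/ g, q %/ g); split.
- split=> /=; first by apply: contraNneq q0 => qg0; rewrite qE qg0 mul0r.
  by apply: coprimep_div_gcd; rewrite q0 orbT.
- have pred_sub a b : ((a - b).-1 <= a.-1)%N by lia.
  by rewrite /ratmap_degree /= !size_divp // geq_max !leq_max !pred_sub orbT.
- by move: qy; rewrite {1}qE hornerM mulf_eq0 negb_or => /andP[].
- have gy : g.[y] != 0 by move: qy; rewrite {1}qE hornerM mulf_eq0 negb_or => /andP[].
  have : \forall z \near y, g.[z] != 0 by apply: (@horner_near_neq0 _ g id).
  apply: filterS => z gz; rewrite /ratmap_fun /= {2}pE {2}qE !hornerM.
  by rewrite invfM mulrACA divff // mulr1.
Qed.

Lemma pade_den_of_pade N k h y r A : is_pade k h y r -> (2 * k <= N)%N ->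
  jet N h y A ->
  exists q P, [/\ pade_den k (A - (A`_0)%:P) q, jet N (ratmap_fun r) y P,
    forall j, (j <= 2 * k)%N -> A`_j = P`_j &
    forall j, (k < j <= N)%N -> (q * P)`_j = 0].
Proof.
move=> [rr degr r0 eqr] le_kN jA; have [P jP qP] := ratmap_jet N r0.
set qy := r.2 \Po _ in qP.
have AP j : (j <= 2 * k)%N -> A`_j = P`_j.
  move=> le_jk; have [[_ eA] [_ eP]] := (iffLR (jetP _ _ _ _) jA, iffLR (jetP _ _ _ _) jP).
  have le_jN := leq_trans le_jk le_kN.
  have := eqr j le_jk; rewrite eA // eP // => /esym/eqP.
  by rewrite eqr_pMn2r ?fact_gt0 // => /eqP.
have [s1 s2] : (size r.1 <= k.+1)%N /\ (size r.2 <= k.+1)%N.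
  by move: degr; rewrite /ratmap_degree geq_max => /andP[]; lia.
(* The denominator of [r], translated to 0 and scaled to constant coefficient 1. *)
exists (r.2.[y]^-1 *: qy), P; split=> //; last first.
  move=> j /andP[lt_kj le_jN]; rewrite -scalerAl coefZ qP // nth_default ?mulr0 //.
  by rewrite size_comp_shift (leq_trans s1).
split.
- by rewrite (leq_trans (size_scale_leq _ _)) // size_comp_shift.
- by rewrite coefZ coef0_shift mulVf.
- move=> j /andP[lt_kj le_j2k].
  have sq : qy`_j = 0 by rewrite nth_default // size_comp_shift (leq_trans s2).
  rewrite -scalerAl coefZ mulrBr coefB coefMC sq mul0r subr0.
  rewrite coefM (eq_bigr (fun i : 'I_j.+1 => qy`_i * P`_(j - i))).
    rewrite -coefM qP ?(leq_trans le_j2k) // nth_default ?mulr0 //.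
    by rewrite size_comp_shift (leq_trans s1).
  by move=> i _; rewrite AP // (leq_trans (leq_subr _ _)).
Qed.

(** The numerator is [q * A] cut after degree [k]; the denominator conditions say that the cut loses
    nothing up to degree [2 * k]. *)
Lemma pade_of_den k h y A q : jet (2 * k) h y A ->
  pade_den k (A - (A`_0)%:P) q -> exists r, is_pade k h y r.
Proof.
move=> jA [sq q0 qA].
pose p := take_poly k.+1 (q * A).
have qy : (q \Po ('X - y%:P)).[y] != 0.
  by rewrite horner_comp !hornerE subrr horner_coef0 q0 oner_eq0.
have [r [rr degr r0 near_r]] := is_ratmap_reduce (p \Po ('X - y%:P)) qy.
have sp : (size p <= k.+1)%N by exact: size_take_poly.
exists r; split=> //.
  apply: leq_trans degr _; rewrite -polyCN !size_comp_shift geq_max.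
  by rewrite -!subn1 !leq_subLR !add1n sp sq.
have [P jP qP] := ratmap_jet (2 * k) (r := (p \Po ('X - y%:P), q \Po ('X - y%:P))) qy.
move: qP; rewrite /= !comp_unshift => qP.
have PA j : (j <= 2 * k)%N -> P`_j = A`_j.
  apply: (@coef_mul_cancel _ q); first by rewrite q0 oner_neq0.
  move=> {}j le_j2k; rewrite qP // coef_take_poly ltnS; case: leqP => // lt_kj.
  have := qA j; rewrite lt_kj le_j2k mulrBr coefB coefMC [q`_j]nth_default.
    by rewrite mul0r subr0 => ->.
  by rewrite (leq_trans sq).
have jr : jet (2 * k) (ratmap_fun r) y A.
  apply: jet_coef PA _; apply: jet_near jP => [|_].
    by rewrite (nbhs_singleton near_r).
  by apply: filterS near_r.
move=> j le_j2k; have [[_ eA] [_ er]] := (iffLR (jetP _ _ _ _) jA, iffLR (jetP _ _ _ _) jr).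
by rewrite eA // er.
Qed.

Lemma coef1_comp A B : A`_0 = 0 -> (B \Po A)`_1 = B`_1 * A`_1.
Proof.
move=> A0; have := coef_deriv (B \Po A) 0; rewrite mulr1n => <-.
rewrite deriv_comp coefM big_ord1 subnn coef0_comp //.
by rewrite !coef_deriv !mulr1n.
Qed.

Lemma schwarzianE k h y A : schwarzian_exists k h y -> jet (2 * k).+1 h y A ->
  exists2 q, pade_den k (A - (A`_0)%:P) q &
    schwarzian k h y =
      (q * (A - (A`_0)%:P))`_(2 * k).+1 / A`_1 *+ (2 * k).+1`!.
Proof.
move=> [k0 dh h0 [_ [r0 rP0]]] jA; pose N := (2 * k).+1.
rewrite /schwarzian /pade; set r := xget _ _.
have rP : [set r | is_pade k h y r] r by apply: xgetPex; exists r0.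
set F := ratmap_fun r; set phi := local_inverse F y.
have [q [P [qden jP AP qP]]] := pade_den_of_pade rP (leqnSn _) jA.
have [_ _ r2y _] := rP; have [_ q0 _] := qden.
have A1 : A`_1 != 0.
  by have [_ /(_ 1)] := iffLR (jetP _ _ _ _) jA; rewrite mulr1n => <-.
exists q => //.
have hF : h y = F y.
  have [_ /(_ 0 isT)] := iffLR (jetP _ _ _ _) jA; have [_ /(_ 0 isT)] := iffLR (jetP _ _ _ _) jP.
  by rewrite !derive1n0 /F => -> ->; rewrite AP.
pose a := (r.1^`() * r.2 - r.1 * r.2^`(), r.2 ^+ 2).
have near_r2 : \forall z \near y, r.2.[z] != 0 by apply: (@horner_near_neq0 _ r.2 id).
have dF : \forall z \near y, is_derive (z : R) 1 F (ratmap_fun a z).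
  by apply: filterS near_r2 => z z0; exact: is_derive_ratmap.
have F1 : ratmap_fun a y = P`_1.
  have [_ /(_ 1 isT)] := iffLR (jetP _ _ _ _) jP; rewrite mulr1n derive1n1 derive1E => <-.
  by have [_ <-] := nbhs_singleton dF.
have a1y : a.1.[y] != 0.
  by apply: contraNneq A1; rewrite AP; [rewrite -F1 /ratmap_fun => ->; rewrite mul0r|lia].
have near_a1 : \forall z \near y, a.1.[z] != 0 by apply: (@horner_near_neq0 _ a.1 id).
have near_F' : \forall z \near y, ratmap_fun a z != 0.
  near=> z; rewrite /ratmap_fun mulf_neq0 //; first by near: z.
  by rewrite invr_neq0 // hornerE expf_neq0 //; near: z.
have phiP : is_local_inverse F y phi := local_inverseP dF near_F'.
have [phiy phiK _] := phiP.
have dphi := is_derive_local_inverse dF near_F' phiP.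
have phi_diff : n_differentiable N phi (F y).
  (* The pair is swapped because the derivative of [phi] is [1 / F'] at [phi]; the rational map
     ['X / 1] returns [phi] itself. *)
  have := @n_differentiable_ratmap_comp _ N phi (F y) (a.2, a.1) ('X, 1).
  rewrite [in X in X -> _ -> _]/= [in X in _ -> X -> _]/= phiy
    [X in _ -> X -> _]/= hornerC oner_eq0 => /(_ _ a1y isT) H.
  apply: (n_differentiable_near _ _ (H _)).
  - by rewrite /ratmap_fun /= hornerX hornerC divr1.
  - by move=> _; near=> z; rewrite /ratmap_fun /= hornerX hornerC divr1.
  - by apply: filterS dphi => w; rewrite /ratmap_fun invf_div.
have jphi := jet_taylor phi_diff; set Phi := taylor N phi (F y) in jphi.
have jphiF := jet_comp jP jphi.
have jid : jet N (phi \o F) y ('X + y%:P).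
  apply: (@jet_near _ _ (horner 'X)) => [|_|].
  - by rewrite /= phiy hornerX.
  - by apply: filterS phiK => z /= ->; rewrite hornerX.
  - by have := jet_horner N 'X y; rewrite comp_polyX.
have PhiP := jet_uniq jphiF jid.
have P00 : (P - (P`_0)%:P)`_0 = 0 by rewrite coefB coefC subrr.
have Phi1 : Phi`_1 * A`_1 = 1.
  have := PhiP 1 isT; rewrite coef1_comp // coefB coefC subr0 AP; last by lia.
  by move=> ->; rewrite coefD coefX coefC addr0.
have AP' : agree N (A`_N - P`_N) (A - (A`_0)%:P) (P - (P`_0)%:P).
  split=> [n lt_nN|]; first by rewrite !coefB !coefC !AP.
  by rewrite !coefB !coefC !subr0 addrC subrK.
have [_ qAN] := agree_mull q AP'.
have jphih : jet N (phi \o h) y (Phi \Po (A - (A`_0)%:P)).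
  by apply: jet_comp jA _; rewrite hF.
have [_ /(_ N (leqnn _)) ->] := iffLR (jetP _ _ _ _) jphih.
congr (_ *+ _); have [//|_ ->] := agree_comp Phi _ P00 AP'.
rewrite PhiP // coefD coefX coefC; rewrite -/N qAN q0 mul1r.
rewrite mulrBr coefB coefMC qP; last by rewrite /N; lia.
have qN : q`_N = 0.
  by have [sq _ _] := qden; rewrite nth_default // (leq_trans sq) // /N; lia.
have -> : (N == 1)%:R + (if N == 0 then y else 0) = 0 :> R.
  by rewrite addr0 (_ : (N == 1) = false) // /N; lia.
by rewrite qN mul0r !sub0r oppr0 !add0r -[Phi`_1](mulfK A1) Phi1 mul1r.
Unshelve. all: by end_near. Qed.

End PadeJets.

(** * The inequality for the composition *)

Lemma schwarzian_denominators (R : realType) (d : nat) (h : R -> R) (y : R)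
    (A : {poly R}) :
  schwarzian_exists d h y ->
  (forall k, (1 <= k)%N -> (k < d)%N ->
     schwarzian_exists k h y /\ 0 <= schwarzian k h y) ->
  jet (2 * d).+1 h y A ->
  let A' := A - (A`_0)%:P in
  exists q : nat -> {poly R},
    [/\ forall k, (0 < k <= d)%N -> pade_den k A' (q k),
        schwarzian d h y =
          (q d * A')`_(2 * d).+1 / A`_1 *+ (2 * d).+1`! &
        forall k, (0 < k < d)%N -> 0 <= (q k * A')`_(2 * k).+1 / A`_1].
Proof.
move=> Sd Sk jA A'.
(* One denominator per order, by choice; outside the range from 1 to [d] the value 0 is
   arbitrary. *)
have /choice[q qP] : forall k, exists q, (0 < k <= d)%N ->
    pade_den k A' q /\
    schwarzian k h y = (q * A')`_(2 * k).+1 / A`_1 *+ (2 * k).+1`!.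
  move=> k; have [/andP[k0 le_kd]|nk] := boolP (0 < k <= d)%N; last first.
    by exists 0.
  have Sk' : schwarzian_exists k h y.
    by move: le_kd; rewrite leq_eqVlt => /predU1P[->//|lt_kd]; have [] := Sk k k0 lt_kd.
  have le_N : ((2 * k).+1 <= (2 * d).+1)%N by rewrite ltnS leq_mul2l.
  have [q qden qS] := schwarzianE Sk' (jet_le le_N jA).
  by exists q.
exists q; split.
- by move=> k kd; have [] := qP k kd.
- by have [d0 _ _ _] := Sd; have [|_ ->] := qP d; first by rewrite d0 leqnn.
- move=> k /andP[k0 lt_kd]; have [_ ge0] := Sk k k0 lt_kd.
  have [|_ eS] := qP k; first by rewrite k0 ltnW.
  by move: ge0; rewrite eS pmulrn_lge0 ?fact_gt0.
Qed.

Theorem proposition3 (R : realType) (d : nat) (x : R) (f g : R -> R)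
  (d_gt0 : (0 < d)%N)
  (f_diff : n_differentiable (2 * d).+1 f x)
  (g_diff : n_differentiable (2 * d).+1 g (f x))
  (Df_neq0 : f^`() x != 0)
  (Dg_neq0 : g^`() (f x) != 0)
  (Sdf : schwarzian_exists d f x)
  (Sdg : schwarzian_exists d g (f x))
  (Sf_ge0 : forall k : nat, (1 <= k)%N -> (k < d)%N ->
     schwarzian_exists k f x /\ 0 <= schwarzian k f x)
  (Sg_ge0 : forall k : nat, (1 <= k)%N -> (k < d)%N ->
     schwarzian_exists k g (f x) /\ 0 <= schwarzian k g (f x)) :
  schwarzian_exists d (g \o f) x /\
  schwarzian d (g \o f) x >=
    schwarzian d g (f x) * (f^`()%classic x) ^+ (2 * d) + schwarzian d f x.
Proof.
have jA := jet_taylor f_diff; set A := taylor _ f x in jA.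
have jB := jet_taylor g_diff; set B := taylor _ g (f x) in jB.
have [qA [padeA SA geA]] := schwarzian_denominators Sdf Sf_ge0 jA.
have [qB [padeB SB geB]] := schwarzian_denominators Sdg Sg_ge0 jB.
have A1 : A`_1 = f^`()%classic x.
  by have [_ /(_ 1 isT)] := iffLR (jetP _ _ _ _) jA.
have B1 : B`_1 = g^`()%classic (f x).
  by have [_ /(_ 1 isT)] := iffLR (jetP _ _ _ _) jB.
set A' := A - _ in padeA SA geA; set B' := B - _ in padeB SB geB.
have A'0 : A'`_0 = 0 by rewrite coefB coefC subrr.
have A'1 : A'`_1 = A`_1 by rewrite coefB coefC subr0.
have B'1 : B'`_1 = B`_1 by rewrite coefB coefC subr0.
have A1_neq0 : A`_1 != 0 by rewrite A1.
have B1_neq0 : B`_1 != 0 by rewrite B1.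
have [||||||[q qden] qge] := @pade_den_comp _ d A' B' qA qB d_gt0 A'0.
- by rewrite A'1.
- by rewrite B'1.
- exact: padeA.
- exact: padeB.
- by rewrite A'1.
- by rewrite B'1.
have jC : jet (2 * d).+1 (g \o f) x (B \Po A') := jet_comp jA jB.
(* The jet of [g \o f] keeps the constant term of [B]; removing it gives the composition treated by
   [pade_den_comp]. *)
have CE : (B \Po A') - ((B \Po A')`_0)%:P = B' \Po A'.
  by rewrite comp_polyB comp_polyC coef0_comp.
have [C_diff eC] := iffLR (jetP _ _ _ _) jC.
have C1 : (B \Po A')`_1 = A`_1 * B`_1 by rewrite coef1_comp // A'1 mulrC.
have SC : schwarzian_exists d (g \o f) x.
  split=> //.
  - by have := eC 1 isT; rewrite mulr1n derive1n1 C1 => ->; rewrite mulf_neq0.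
  - split; first exact: n_differentiable_le (leqnSn _) C_diff.
    by apply: (pade_of_den (q := q) (jet_le (leqnSn _) jC)); rewrite CE.
split=> //; have [q' q'den ->] := schwarzianE SC jC.
move: q'den; rewrite CE C1 => /qge; rewrite A'1 B'1 SA SB -A1 => le_q.
by rewrite mulrnAl -mulrnDl ler_wMn2r.
Qed.
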